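(* The Lagrangian homothetic solitons for the inverse mean curvature flow with constant velocity $a\neq 0$ in $\mathbb{C}^n$ that are products of $n$ regular plane curves, i.e. of the form $\phi(s_1,\dots,s_n)=(\alpha_1(s_1),\dots,\alpha_n(s_n))$ with $\alpha_1,\dots,\alpha_n$ regular curves in $\mathbb{C}$, are given (up to dilations and congruences) by: 1. $\mathbb{S}^1 \times \stackrel{n)}{\cdots} \times \mathbb{S}^1 \hookrightarrow \mathbb{C}^{n}$ (product of $n$ unit circles centered at the origin), with $a=1/n$; 2. $\mathbb{S}^1 \times \stackrel{k)}{\cdots} \times \mathbb{S}^1 \times \mathbb{R}^{n-k} \hookrightarrow \mathbb{C}^{n}$ (product of $k$ unit circles centered at the origin and $n-k$ straight lines through the origin), $1\leq k \leq n-1$, with $a=1/k$; 3. $\mathcal C \times \mathbb{R}^{n-1}\hookrightarrow \mathbb{C}^{n}$, where $\mathcal C$ is a homothetic soliton for the inverse curve shortening flow, with $a\neq 0$ the constant velocity of $\mathcal C$.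
   Context: Let $\phi : M^n \to \mathbb{R}^m$ be an isometric immersion of an $n$-dimensional Riemannian manifold, with second fundamental form $\sigma$ and mean curvature vector $H=\mathrm{trace}\,\sigma$ (not divided by $n$), assumed nowhere vanishing. $\phi$ is a homothetic soliton for the inverse mean curvature flow with constant velocity $a\neq 0$ ($a$ a real constant) if $-\frac{H}{|H|^2}=a\,\phi^\bot$, where $\phi^\bot$ is the projection of the position vector $\phi$ onto the normal bundle. This condition is invariant under dilations $\phi\mapsto\rho\phi$, $\rho>0$. An immersion $\phi:M^n\to\mathbb{C}^n$ is Lagrangian if $\phi^*\omega=0$, where $\omega(\cdot,\cdot)=\langle J\cdot,\cdot\rangle$ and $J$ is the complex structure of $\mathbb{C}^n$; products of $n$ regular plane curves are always Lagrangian. A regular plane curve $\alpha$ in $\mathbb{C}$ with signed curvature $\kappa$ is a homothetic soliton for the inverse curve shortening flow with constant velocity $a\neq0$ if $a\,\kappa\langle\alpha',J\alpha\rangle=|\alpha'|$, where $J$ is the rotation by $+\pi/2$. The curves are considered as parametrized curves on intervals, so the circles and lines above are understood up to the extent of the parameter intervals. *)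

(* Defs.v *)
From HB Require Import structures.
From mathcomp Require Import all_boot all_order all_algebra perm.
From mathcomp Require Import all_classical all_reals all_analysis.
Import Order.TTheory GRing.Theory Num.Theory.
Import numFieldNormedType.Exports.

Set Implicit Arguments.
Unset Strict Implicit.
Unset Printing Implicit Defensive.

Local Open Scope classical_set_scope.
Local Open Scope ring_scope.

(* The plane C is 'rV[R]_2 (real and imaginary part), and C^n is 'M[R]_(n, 2),
   whose row i is the i-th complex coordinate.  The norm of the library on
   matrices is the sup norm; lengths below always use the Euclidean [enorm]. *)

Section Euclidean.
Context {R : realType} {p q : nat}.
Implicit Types u v : 'M[R]_(p, q).

Definition edot u v : R := \sum_i \sum_j u i j * v i j.

Definition enorm u : R := Num.sqrt (edot u u).

End Euclidean.

Section ComplexStructure.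
Context {R : realType} {n : nat}.
Implicit Types u v : 'M[R]_(n, 2).

(* (x, y) |-> (- y, x) on each row *)
Definition cJ u : 'M[R]_(n, 2) :=
  \matrix_(i, j) (if j == 0 then - u i 1 else u i 0).

Definition omega u v : R := edot (cJ u) v.

(* elements of U(n): the real-linear isometries that commute with J *)
Definition unitary (f : {linear 'M[R]_(n, 2) -> 'M[R]_(n, 2)}) : Prop :=
  (forall u v, edot (f u) (f v) = edot u v) /\
  (forall u, f (cJ u) = cJ (f u)).

End ComplexStructure.

(* Immersions of an open set U of R^n, carrying the metric induced by phi. *)
Section Immersion.
Context {R : realType} {n p q : nat}.
Implicit Types (U : set 'rV[R]_n) (phi : 'rV[R]_n -> 'M[R]_(p, q)).
Implicit Types (s : 'rV[R]_n) (v : 'M[R]_(p, q)) (i j : 'I_n).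

Definition partial i phi : 'rV[R]_n -> 'M[R]_(p, q) :=
  fun s => 'D_(delta_mx 0 i) phi s.

Fixpoint Ck_on (k : nat) U phi : Prop :=
  if k is k'.+1 then
    (forall s, U s -> differentiable phi s) /\
    (forall i, Ck_on k' U (partial i phi))
  else forall s, U s -> {for s, continuous phi}.

Definition immersion_on U phi : Prop :=
  (forall k, Ck_on k U phi) /\
  (forall s u, U s -> 'D_u phi s = 0 -> u = 0).

Definition gram phi s : 'M[R]_n :=
  \matrix_(i, j) edot (partial i phi s) (partial j phi s).

(* orthogonal projections of v onto the tangent and normal spaces at s *)
Definition tangent_part phi s v : 'M[R]_(p, q) :=
  \sum_i \sum_j
    (invmx (gram phi s) i j * edot v (partial i phi s)) *: partial j phi s.

Definition normal_part phi s v : 'M[R]_(p, q) := v - tangent_part phi s v.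

(* sigma (d_i, d_j) *)
Definition second_ff phi s i j : 'M[R]_(p, q) :=
  normal_part phi s (partial i (partial j phi) s).

(* the trace of sigma for the induced metric, not divided by n *)
Definition mean_curvature phi s : 'M[R]_(p, q) :=
  \sum_i \sum_j invmx (gram phi s) i j *: second_ff phi s i j.

Definition imcf_soliton (a : R) U phi : Prop :=
  [/\ immersion_on U phi,
      forall s, U s -> mean_curvature phi s != 0 &
      forall s, U s ->
        - ((enorm (mean_curvature phi s) ^+ 2)^-1 *: mean_curvature phi s) =
        a *: normal_part phi s (phi s)].

End Immersion.

Definition lagrangian {R : realType} {n : nat} (U : set 'rV[R]_n)
    (phi : 'rV[R]_n -> 'M[R]_(n, 2)) : Prop :=
  forall s u v, U s -> omega ('D_u phi s) ('D_v phi s) = 0.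

Section PlaneCurves.
Context {R : realType}.
Implicit Types (I : set R) (alpha : R -> 'rV[R]_2).

Definition open_interval I : Prop := [/\ open I, is_interval I & I !=set0].

Definition regular_curve I alpha : Prop :=
  (forall k t, I t -> derivable (derive1n k alpha) t 1) /\
  (forall t, I t -> derive1 alpha t != 0).

Definition signed_curvature alpha (t : R) : R :=
  edot (derive1n 2 alpha t) (cJ (derive1 alpha t)) / enorm (derive1 alpha t) ^+ 3.

Definition icsf_soliton (a : R) I alpha : Prop :=
  forall t, I t ->
    a * signed_curvature alpha t * edot (derive1 alpha t) (cJ (alpha t)) =
    enorm (derive1 alpha t).

(* The traces are only required to be contained in the circle or the line:
   with regularity, these are arcs of it, run through at any speed. *)
Definition in_unit_circle I alpha : Prop :=
  forall t, I t -> enorm (alpha t) = 1.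

Definition in_real_line I alpha : Prop := forall t, I t -> alpha t 0 1 = 0.

End PlaneCurves.

Section ProductOfCurves.
Context {R : realType} {n : nat}.

Definition box (I : 'I_n -> set R) : set 'rV[R]_n :=
  [set s | forall i, I i (s 0 i)].

Definition curve_product (alpha : 'I_n -> R -> 'rV[R]_2) (s : 'rV[R]_n) :
    'M[R]_(n, 2) :=
  \matrix_(i, j) alpha i (s 0 i) 0 j.

(* Up to a dilation of ratio rho, a congruence f and the order tau of the
   factors, the product of the alpha i is that of the beta i.  Solitons are
   not invariant under translations, so congruences fix the origin.  As
   [col_perm tau s 0 i = s 0 (tau i)], beta i has the domain I (tau i). *)
Definition similar_products (I : 'I_n -> set R)
    (alpha : 'I_n -> R -> 'rV[R]_2)
    (J : 'I_n -> set R) (beta : 'I_n -> R -> 'rV[R]_2) : Prop :=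
  exists (rho : R) (f : {linear 'M[R]_(n, 2) -> 'M[R]_(n, 2)}) (tau : 'S_n),
    [/\ 0 < rho, unitary f, forall i, J i = I (tau i) &
        forall s, box I s ->
          curve_product beta (col_perm tau s) =
          rho *: f (curve_product alpha s)].

End ProductOfCurves.

(* Main.v *)
(* The vectors [J alpha_i'] span the normal spaces of a product of curves, so the
   soliton condition reads [- kappa_i = a p_i S] for all i, where
   [p_i = <alpha_i, J alpha_i'> / |alpha_i'|] and [S] is the sum of the squared
   curvatures.  If [kappa_i] vanishes identically then so does [p_i], and
   [alpha_i] runs on a line through the origin.  If [kappa_i] is nonzero at some
   [s_i], the equation at [s_i] determines [S], so that all the other squared
   curvatures are constant.  Hence, either a single factor is curved, and the
   equation is that of an inverse curve shortening soliton, or [S] and all the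
   [kappa_i^2] are constant; then [p_i^2] is constant as well, which forces
   [<alpha_i, alpha_i'> = 0] on the curved factors: they are circles centred at
   the origin, of common squared radius [1 / (a S)], and [a = 1 / k].

   Square roots are avoided: curves enter through [|alpha'|^2],
   [<alpha'', J alpha'>] and [<alpha, J alpha'>], called [speed2], [turning]
   and [support] ([w], [X] and [P] for short). *)

Require Import Defs.
From HB Require Import structures.
From mathcomp Require Import all_boot all_order all_algebra perm.
From mathcomp Require Import all_classical all_reals all_analysis.
From mathcomp Require Import ring lra.
Import Order.TTheory GRing.Theory Num.Theory.
Import numFieldNormedType.Exports.

Set Implicit Arguments.
Unset Strict Implicit.

Local Open Scope classical_set_scope.
Local Open Scope ring_scope.

(** * Calculus of vector-valued functions *)

Section VectorCalculus.
Context {R : realType}.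

Lemma is_derive_mxP (V : normedModType R) (m n : nat) (M : V -> 'M[R]_(m, n))
    (D : 'M[R]_(m, n)) (t v : V) :
  is_derive t v M D <->
  (forall i j, is_derive t v (fun x => M x i j) (D i j)).
Proof.
split=> [[dM <-] i j | dM].
  by apply: DeriveDef; [move/derivable_mxP: dM | rewrite derive_mx // mxE].
have dMt : derivable M t v by apply/derivable_mxP => i j; case: (dM i j).
apply: DeriveDef => //; rewrite derive_mx //; apply/matrixP => i j.
by rewrite mxE; case: (dM i j).
Qed.

Lemma derivable1_is_derive (V : normedModType R) (f : R -> V) (t : R) :
  derivable f t 1 -> is_derive t 1 f (derive1 f t).
Proof. by move=> df; apply: DeriveDef => //; rewrite derive1E. Qed.

Lemma is_derive1E (V : normedModType R) (f : R -> V) (t : R) (df : V) :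
  is_derive t 1 f df -> derive1 f t = df.
Proof. by move=> [_ <-]; rewrite derive1E. Qed.

Lemma open_near_eq (T : topologicalType) (V : Type) (U : set T) (f g : T -> V) t :
  open U -> (forall x, U x -> f x = g x) -> U t -> \forall x \near t, f x = g x.
Proof. by move=> oU fg Ut; apply: filterS (open_nbhs_nbhs (conj oU Ut)). Qed.

Lemma is_derive_near_cst (U : set R) (f : R -> R) (t c d : R) :
  open U -> (forall x, U x -> f x = c) -> U t -> is_derive t 1 f d -> d = 0.
Proof.
move=> oU fc Ut [_ <-].
rewrite (@near_eq_derive _ _ _ f (cst c)) ?derive_cst //.
exact: open_near_eq fc Ut.
Qed.

Lemma interval_cst (U : set R) (f : R -> R) (x y : R) :
  is_interval U -> (forall t, U t -> is_derive t 1 f 0) ->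
  U x -> U y -> f x = f y.
Proof.
move=> iU df; wlog xy : x y / x <= y => [H Ux Uy | Ux Uy].
  by case: (leP x y) => [/H | /ltW /H H']; [apply | rewrite H'].
have inU z : z \in `[x, y] -> U z.
  by rewrite in_itv /= => /andP[xz zy]; apply: iU Ux Uy _ _; rewrite xz zy.
rewrite -(subKr (f y) (f x)).
have [| |c _ ->] := @MVT_segment R f (cst 0) x y xy.
- by move=> z zxy; apply/df/inU; apply: subset_itv_oo_cc zxy.
- by apply: derivable_within_continuous => z zxy; case: (df _ (inU _ zxy)).
by rewrite mul0r subr0.
Qed.

Lemma edot_rV2 (u v : 'rV[R]_2) : edot u v = u 0 0 * v 0 0 + u 0 1 * v 0 1.
Proof.
rewrite /edot big_ord1 big_ord_recl big_ord1.
by congr (_ + u _ _ * v _ _); apply/val_inj.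
Qed.

Lemma cJ0 n (u : 'M[R]_(n, 2)) i : cJ u i 0 = - u i 1.
Proof. by rewrite mxE. Qed.

Lemma cJ1 n (u : 'M[R]_(n, 2)) i : cJ u i 1 = u i 0.
Proof. by rewrite mxE. Qed.

Definition planeE := (@edot_rV2, @cJ0, @cJ1).

Lemma rV2P (u v : 'rV[R]_2) : u 0 0 = v 0 0 -> u 0 1 = v 0 1 -> u = v.
Proof.
move=> e0 e1; apply/rowP; case=> [[|[|j]] // j2].
  by move: e0; congr (_ = _); congr (_ _ _); apply/val_inj.
by move: e1; congr (_ = _); congr (_ _ _); apply/val_inj.
Qed.
End VectorCalculus.

(** * Differentiation of products of curves *)

Section ProductCalculus.
Context {R : realType} {n : nat}.
Implicit Types (gamma : 'I_n -> R -> 'rV[R]_2) (I : 'I_n -> set R) (s : 'rV[R]_n).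

(** The shape of the vectors of [C^n] that come from the [i]-th factor alone, such as the partial
    derivatives of a product of curves. *)
Definition inrow (i : 'I_n) (v : 'rV[R]_2) : 'M[R]_(n, 2) :=
  \matrix_(k, j) (if k == i then v 0 j else 0).

Lemma differentiable_mx (V : normedModType R) (p q : nat)
    (M : V -> 'M[R]_(p, q)) (x : V) :
  (forall i j, differentiable (fun y => M y i j) x) -> differentiable M x.
Proof.
move=> dM.
rewrite (_ : M = \sum_i \sum_j (fun y => M y i j *: delta_mx i j)).
  apply: differentiable_sum => i; apply: differentiable_sum => j.
  exact: differentiableZl.
apply/funext => y; rewrite [LHS]matrix_sum_delta fct_sumE.
by apply: eq_bigr => i _; rewrite fct_sumE.
Qed.

Lemma curve_product_coord gamma i j :
  (fun s => curve_product gamma s i j) =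
  (fun t : R => gamma i t 0 j) \o (fun s : 'rV[R]_n => s 0 i).
Proof. by apply/funext => s; rewrite mxE. Qed.

Lemma curve_product_differentiable gamma s :
  (forall i, derivable (gamma i) (s 0 i) 1) ->
  differentiable (curve_product gamma) s.
Proof.
move=> dg; apply: differentiable_mx => i j; rewrite curve_product_coord.
apply: differentiable_comp; first exact: differentiable_coord.
by apply/derivable1_diffP; move/derivable_mxP: (dg i).
Qed.

Lemma curve_product_is_derive gamma s u :
  (forall i, derivable (gamma i) (s 0 i) 1) ->
  is_derive s u (curve_product gamma)
    (\matrix_(i, j) (u 0 i * derive1 (gamma i) (s 0 i) 0 j)).
Proof.
move=> dg; apply: DeriveDef.
  exact: diff_derivable (curve_product_differentiable dg).
rewrite derive_mx; last exact: diff_derivable (curve_product_differentiable dg).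
apply/matrixP => i j; rewrite !mxE.
have dgij : differentiable (fun t => gamma i t 0 j) (s 0 i).
  by apply/derivable1_diffP; move/derivable_mxP: (dg i).
(* Both derivatives are limits of the same difference quotients, as this entry depends on [s 0 i]
   only. *)
transitivity ('D_(u 0 i) (fun t => gamma i t 0 j) (s 0 i)).
  rewrite /derive curve_product_coord.
  have limE (F G : R -> R) : F = G -> lim (F @ 0^') = lim (G @ 0^') by move->.
  by apply: limE; apply/funext => h /=; rewrite !mxE.
rewrite deriveE // -[X in 'd _ _ X]mulr1 linearZ /= -deriveE //.
by congr (_ * _); rewrite derive1E derive_mx ?mxE.
Qed.

Lemma curve_product_partial gamma s i :
  (forall i, derivable (gamma i) (s 0 i) 1) ->
  partial i (curve_product gamma) s = inrow i (derive1 (gamma i) (s 0 i)).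
Proof.
move=> dg; rewrite /partial.
have [_ ->] := curve_product_is_derive (delta_mx 0 i) dg.
apply/matrixP => k j; rewrite !mxE eqxx /=.
by case: eqP => [->|_]; rewrite ?mul1r ?mul0r.
Qed.

Lemma open_box I : (forall i, open (I i)) -> open (box I).
Proof.
move=> oI; rewrite openE => s Is.
exists (fun _ k => I k) => [i j | t It i]; last exact: It.
by rewrite ord1; apply: open_nbhs_nbhs; split; [exact: oI | exact: Is].
Qed.

(** The expansion of [f] at [x] is also one of [g]; uniqueness of the differential then identifies
    ['d g x] with ['d f x]. *)
Lemma near_eq_differentiable (V W : normedModType R) (f g : V -> W) (x : V) :
  (\forall y \near x, f y = g y) -> differentiable f x -> differentiable g x.
Proof.
move=> fg /diff_locallyP[dfc /eqaddoP df].
suff dg : g \o shift x = cst (g x) + 'd f x +o_ 0 id.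
  by apply/diff_locallyP; rewrite (diff_unique dfc dg).
apply/eqaddoP => e e0; have := df e e0.
have fg0 : \forall h \near 0, f (h + x) = g (h + x).
  by move: fg; rewrite (near_shift 0 x); apply: filterS => h; rewrite /= subr0.
have fgx : f x = g x := nbhs_singleton fg.
by apply: filterS2 fg0 => h /= fgh; rewrite !fctE /= fgh fgx.
Qed.

(** The partial derivatives of a product of curves are known on the box only, while [Ck_on] speaks
    of functions on the whole space; as [U] is open, equality on it passes to partial
    derivatives. *)
Lemma Ck_on_ext (p q k : nat) (U : set 'rV[R]_n)
    (f g : 'rV[R]_n -> 'M[R]_(p, q)) :
  open U -> (forall s, U s -> f s = g s) -> Ck_on k U f -> Ck_on k U g.
Proof.
move=> oU; elim: k f g => [|k IHk] f g fg /=.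
  move=> cf s Us; rewrite /prop_for /continuous_at -(fg s Us).
  apply: cvg_trans (cf s Us); apply: near_eq_cvg; first exact: (@nbhs_filter _ s).
  exact: open_near_eq fg Us.
move=> [df ck]; split=> [s Us | i].
  by apply: near_eq_differentiable (df s Us); apply: open_near_eq fg Us.
apply: IHk (ck i) => s Us; rewrite /partial; apply: near_eq_derive.
exact: open_near_eq fg Us.
Qed.

End ProductCalculus.

(** * The soliton equation of a product of curves *)

Section SolitonEquation.
Context {R : realType}.
Implicit Types (c : R -> 'rV[R]_2) (t : R).

Definition speed2 c t : R := edot (derive1 c t) (derive1 c t).

Definition turning c t : R := edot (derive1n 2 c t) (cJ (derive1 c t)).

Definition support c t : R := edot (c t) (cJ (derive1 c t)).

(** The square of the signed curvature [turning / |c'|^3]. *)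
Definition curvature2 c t : R := turning c t ^+ 2 / speed2 c t ^+ 3.

Lemma edot_ge0 p q (u : 'M[R]_(p, q)) : 0 <= edot u u.
Proof. by do 2!apply: sumr_ge0 => ? _; rewrite -expr2 sqr_ge0. Qed.

Lemma edot_eq0 p q (u : 'M[R]_(p, q)) : (edot u u == 0) = (u == 0).
Proof.
apply/eqP/eqP => [u0 | ->]; last first.
  by apply: big1 => i _; apply: big1 => j _; rewrite mxE mul0r.
apply/matrixP => i j; rewrite mxE; apply/eqP; rewrite -sqrf_eq0 expr2.
have h0 k : 0 <= \sum_l u k l * u k l.
  by apply: sumr_ge0 => ? _; rewrite -expr2 sqr_ge0.
move/eqP: u0; rewrite psumr_eq0; last by move=> k _; exact: h0.
move/allP/(_ i (mem_index_enum _)) => /=.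
rewrite psumr_eq0; last by move=> ? _; rewrite -expr2 sqr_ge0.
by move/allP/(_ j (mem_index_enum _)).
Qed.

Lemma edotC p q (u v : 'M[R]_(p, q)) : edot u v = edot v u.
Proof. by apply: eq_bigr => i _; apply: eq_bigr => j _; rewrite mulrC. Qed.

Lemma edot_rows p q (u v : 'M[R]_(p, q)) :
  edot u v = \sum_i edot (row i u) (row i v).
Proof.
apply: eq_bigr => i _; rewrite /edot big_ord1.
by apply: eq_bigr => j _; rewrite !mxE.
Qed.

Lemma enorm2 p q (u : 'M[R]_(p, q)) : enorm u ^+ 2 = edot u u.
Proof. by rewrite sqr_sqrtr ?edot_ge0. Qed.

Lemma speed2_gt0 c t : derive1 c t != 0 -> 0 < speed2 c t.
Proof. by move=> ct0; rewrite lt_def edot_ge0 edot_eq0 ct0. Qed.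

Lemma invmx_diag m (d : 'rV[R]_m) : (forall i, d 0 i != 0) ->
  invmx (diag_mx d) = diag_mx (\row_i (d 0 i)^-1).
Proof.
move=> d0; have dd : diag_mx (\row_i (d 0 i)^-1) *m diag_mx d = 1%:M.
  rewrite mul_diag_mx; apply/matrixP => i j; rewrite !mxE.
  by case: eqP => [->|]; rewrite ?mulr0 // mulVf.
have [_ du] := mulmx1_unit dd.
by rewrite -[LHS]mul1mx -dd mulmxK.
Qed.

Variable n : nat.
Implicit Types (alpha gamma : 'I_n -> R -> 'rV[R]_2) (I : 'I_n -> set R).
Implicit Types (s : 'rV[R]_n) (i j : 'I_n).

(** Regularity without the condition on the velocity: the class contains the zero curve and is
    closed under derivation. *)
Definition smooth_curve (U : set R) c : Prop :=
  forall k t, U t -> derivable (derive1n k c) t 1.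

Lemma smooth_curve0 (U : set R) c : smooth_curve U c ->
  forall t, U t -> derivable c t 1.
Proof. by move=> sc t /(sc 0%N). Qed.

Lemma smooth_curve_derive1 (U : set R) c :
  smooth_curve U c -> smooth_curve U (derive1 c).
Proof. by move=> sc k t /(sc k.+1); rewrite /derive1n iterSr. Qed.

Lemma smooth_curve_cst0 (U : set R) : smooth_curve U (cst (0 : 'rV[R]_2)).
Proof.
have E k : derive1n k (cst (0 : 'rV[R]_2)) = cst (0 : 'rV[R]_2).
  elim: k => // k IHk; rewrite derive1nS IHk; apply/funext => t.
  exact: derive1_cst.
by move=> k t _; rewrite E; exact: derivable_cst.
Qed.

(** With these factors a partial derivative of a product of curves is again a product of curves,
    which allows induction on the order of derivation. *)
Definition only (i : 'I_n) c : 'I_n -> R -> 'rV[R]_2 :=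
  fun j => if j == i then c else cst 0.

Lemma curve_product_only i c s : curve_product (only i c) s = inrow i (c (s 0 i)).
Proof.
by apply/matrixP => k j; rewrite !mxE /only; case: eqP => [-> //|_]; rewrite mxE.
Qed.

Lemma only_smooth I i c :
  smooth_curve (I i) c -> forall j, smooth_curve (I j) (only i c j).
Proof.
by move=> sc j; rewrite /only; case: eqP => [->|_] //; exact: smooth_curve_cst0.
Qed.

Lemma curve_product_Ck I gamma k : (forall i, open (I i)) ->
  (forall i, smooth_curve (I i) (gamma i)) ->
  Ck_on k (box I) (curve_product gamma).
Proof.
move=> oI; elim: k gamma => [|k IHk] gamma sg.
  move=> s Is; apply: differentiable_continuous.
  by apply: curve_product_differentiable => i; exact: smooth_curve0 (sg i) _ (Is i).
split=> [s Is | i].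
  by apply: curve_product_differentiable => i; exact: smooth_curve0 (sg i) _ (Is i).
have := IHk _ (only_smooth (smooth_curve_derive1 (sg i))).
apply: Ck_on_ext; first exact: open_box.
move=> s Is; rewrite curve_product_only curve_product_partial // => j.
exact: smooth_curve0 (sg j) _ (Is j).
Qed.

(** The soliton equation for arbitrary functions of one variable each, so that the separation of
    variables is free of geometry. The first conjunct expresses that the mean curvature vector does
    not vanish. *)
Definition separated_equation (a : R) I (w X P K : 'I_n -> R -> R) : Prop :=
  forall s, box I s ->
  \sum_k K k (s 0 k) != 0 /\
  forall i, - X i (s 0 i) / w i (s 0 i) =
            a * P i (s 0 i) * \sum_k K k (s 0 k).

Definition product_equation (a : R) I alpha : Prop :=
  separated_equation a I (fun i => speed2 (alpha i)) (fun i => turning (alpha i))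
    (fun i => support (alpha i)) (fun i => curvature2 (alpha i)).

Section FixedProduct.
Variables (I : 'I_n -> set R) (alpha : 'I_n -> R -> 'rV[R]_2).
Hypothesis oI : forall i, open (I i).
Hypothesis alphaP : forall i, regular_curve (I i) (alpha i).
Variable s : 'rV[R]_n.
Hypothesis Is : box I s.
Local Notation phi := (curve_product alpha).
Local Notation w i := (speed2 (alpha i) (s 0 i)).
Local Notation X i := (turning (alpha i) (s 0 i)).
Local Notation P i := (support (alpha i) (s 0 i)).
Local Notation alpha' i := (derive1 (alpha i) (s 0 i)).

Let dalpha i : derivable (alpha i) (s 0 i) 1.
Proof. by have [sa _] := alphaP i; exact: (sa 0%N) _ (Is i). Qed.

Lemma partial_product i : partial i phi s = inrow i (alpha' i).
Proof. exact: curve_product_partial. Qed.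

Lemma partial2_product i j : partial i (partial j phi) s =
  if i == j then inrow i (derive1n 2 (alpha i) (s 0 i)) else 0.
Proof.
have -> : partial i (partial j phi) s =
    partial i (curve_product (only j (derive1 (alpha j)))) s.
  apply: near_eq_derive; apply: (open_near_eq (open_box oI)) Is => u Iu.
  rewrite curve_product_only; apply: curve_product_partial => k.
  by have [sa _] := alphaP k; exact: (sa 0%N) _ (Iu k).
rewrite curve_product_partial => [|k]; last first.
  rewrite /only; case: eqP => [->|_]; last exact: derivable_cst.
  by have [sa _] := alphaP j; exact: (sa 1%N) _ (Is j).
rewrite /only; case: eqP => [-> //|_].
by rewrite derive1_cst; apply/matrixP => k l; rewrite !mxE; case: ifP; rewrite ?mxE.
Qed.

Lemma edot_inrowr (M : 'M[R]_(n, 2)) i (v : 'rV[R]_2) :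
  edot M (inrow i v) = edot (row i M) v.
Proof.
rewrite edot_rows (bigD1 i) //= big1 ?addr0 => [|k /negbTE ki].
  by congr (edot _ _); apply/rowP => l; rewrite !mxE eqxx.
rewrite /edot big_ord1; apply: big1 => l _.
by rewrite !mxE ki mulr0.
Qed.

Lemma row_inrow i k (v : 'rV[R]_2) :
  row k (inrow i v) = if k == i then v else 0.
Proof. by apply/rowP => l; rewrite !mxE; case: ifP; rewrite ?mxE. Qed.

Let w_gt0 i : 0 < w i.
Proof. by apply: speed2_gt0; have [_] := alphaP i; apply; exact: Is. Qed.

(** The partial derivatives lie in distinct rows, hence are orthogonal. *)
Lemma invmx_gram : invmx (gram phi s) = diag_mx (\row_i (w i)^-1).
Proof.
have -> : gram phi s = diag_mx (\row_i w i).
  apply/matrixP => i j; rewrite !mxE !partial_product edot_inrowr row_inrow.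
  rewrite eq_sym; case: eqP => [-> //|_]; rewrite mulr0n.
  by rewrite edot_rV2 !mxE !mul0r addr0.
rewrite invmx_diag => [|i]; last by rewrite mxE gt_eqF.
by congr diag_mx; apply/rowP => i; rewrite !mxE.
Qed.

(** Removing from a plane vector its component along [alpha' i] leaves the one along
    [cJ (alpha' i)]. *)
Lemma row_normal_part M i :
  row i (normal_part phi s M) =
  (edot (row i M) (cJ (alpha' i)) / w i) *: cJ (alpha' i).
Proof.
rewrite /normal_part.
have -> : tangent_part phi s M =
    \sum_i ((w i)^-1 * edot (row i M) (alpha' i)) *: inrow i (alpha' i).
  rewrite /tangent_part; apply: eq_bigr => k _.
  rewrite (bigD1 k) //= big1 ?addr0 => [|l lk].
    by rewrite invmx_gram !mxE eqxx mulr1n !partial_product edot_inrowr.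
  by rewrite invmx_gram !mxE eq_sym (negbTE lk) mulr0n mul0r scale0r.
rewrite linearB linear_sum /=.
rewrite (bigD1 i) //= big1 ?addr0 => [|l li]; last first.
  by rewrite linearZ /= row_inrow eq_sym (negbTE li) scaler0.
rewrite linearZ /= row_inrow eqxx.
have := w_gt0 i; rewrite /speed2; move: (row i M) (alpha' i) => u v.
rewrite !edot_rV2 => w0; apply: rV2P; rewrite !mxE ?eqxx /=.
  by field; rewrite gt_eqF.
by field; rewrite gt_eqF.
Qed.

(** The metric is diagonal, so the trace involves [second_ff phi s k k] only, and this vector is
    concentrated in row [k]. *)
Lemma row_mean_curvature i :
  row i (mean_curvature phi s) = (X i / w i ^+ 2) *: cJ (alpha' i).
Proof.
have -> : mean_curvature phi s = \sum_k (w k)^-1 *: second_ff phi s k k.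
  apply: eq_bigr => k _; rewrite (bigD1 k) //= big1 ?addr0 => [|l lk].
    by rewrite invmx_gram !mxE eqxx mulr1n.
  by rewrite invmx_gram !mxE eq_sym (negbTE lk) mulr0n scale0r.
rewrite linear_sum (bigD1 i) //= big1 ?addr0 => [|l li]; last first.
  rewrite linearZ /= row_normal_part partial2_product eqxx row_inrow eq_sym.
  by rewrite (negbTE li) edot_rV2 !mxE !mul0r addr0 mul0r scale0r scaler0.
rewrite linearZ /= row_normal_part partial2_product eqxx row_inrow eqxx scalerA.
by congr (_ *: _); rewrite -/(turning _ _); field; rewrite gt_eqF.
Qed.

Lemma edot_cJ (u v : 'rV[R]_2) : edot (cJ u) (cJ v) = edot u v.
Proof. by rewrite !planeE; ring. Qed.

Lemma edot_mean_curvature :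
  edot (mean_curvature phi s) (mean_curvature phi s) =
  \sum_i curvature2 (alpha i) (s 0 i).
Proof.
rewrite edot_rows; apply: eq_bigr => i _; rewrite row_mean_curvature.
have -> k (u : 'rV[R]_2) : edot (k *: u) (k *: u) = k ^+ 2 * edot u u.
  by rewrite !edot_rV2 !mxE; ring.
rewrite edot_cJ -/(speed2 _ _) /curvature2; field.
by rewrite gt_eqF.
Qed.

(** Both sides are normal: row [i] of each is a multiple of the nonzero vector [cJ (alpha' i)], and
    the coefficients are compared. *)
Lemma soliton_equation_at (a : R) :
  - ((enorm (mean_curvature phi s) ^+ 2)^-1 *: mean_curvature phi s) =
    a *: normal_part phi s (phi s) <->
  (forall i, - ((\sum_k curvature2 (alpha k) (s 0 k))^-1 * X i / w i) = a * P i).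
Proof.
rewrite enorm2 edot_mean_curvature; set S := \sum_k _.
have rphi i : row i (phi s) = alpha i (s 0 i).
  by apply/rowP => j; rewrite !mxE.
have J0 i (k : R) : k *: cJ (alpha' i) = 0 -> k = 0.
  move=> /eqP; rewrite scaler_eq0 => /orP[/eqP //|].
  by rewrite -edot_eq0 edot_cJ (gt_eqF (w_gt0 i)).
have E i : row i (- (S^-1 *: mean_curvature phi s) - a *: normal_part phi s (phi s)) =
   ((- (S^-1 * X i / w i) - a * P i) / w i) *: cJ (alpha' i).
  rewrite [LHS]linearB /= [row i (- _)]linearN /= ![row i (_ *: _)]linearZ /=.
  rewrite row_normal_part rphi row_mean_curvature.
  rewrite !scalerA -scaleNr -scalerBl; congr (_ *: _).
  (* The inverse of [S] is generalized, since [S] is not known to be nonzero at this stage. *)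
  by rewrite -/(support _ _); move: S^-1 => S1; field; rewrite gt_eqF.
split=> [/eqP | eqs].
  rewrite -subr_eq0 => /eqP e0 i; have := E i.
  rewrite e0 linear0 => /esym /J0 /eqP.
  rewrite mulf_eq0 invr_eq0 (gt_eqF (w_gt0 i)) orbF subr_eq0.
  by move/eqP.
apply/eqP; rewrite -subr_eq0; apply/eqP/row_matrixP => i.
by rewrite E eqs subrr mul0r scale0r linear0.
Qed.
End FixedProduct.

(** Products of regular curves are Lagrangian immersions: in each row all derivatives are multiples
    of one velocity. What remains is the vector equation and [H != 0], and the latter allows the
    inverse of the sum of squared curvatures to be cleared. *)
Lemma product_solitonP I alpha (a : R) : (forall i, open (I i)) ->
  (forall i, regular_curve (I i) (alpha i)) ->
  (lagrangian (box I) (curve_product alpha) /\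
   imcf_soliton a (box I) (curve_product alpha)) <->
  product_equation a I alpha.
Proof.
move=> oI alphaP.
have dalpha s : box I s -> forall i, derivable (alpha i) (s 0 i) 1.
  by move=> Is i; have [sa _] := alphaP i; exact: (sa 0%N) _ (Is i).
have eqS (S x w p : R) : S != 0 -> - (S^-1 * x / w) = p <-> - x / w = p * S.
  move=> S0; move: w^-1 => v; have SV := mulVf S0.
  split=> [<- | e].
    by transitivity (- x * v * (S^-1 * S)); [rewrite SV | ]; ring.
  transitivity (- x * v * S^-1); first by ring.
  by rewrite e -mulrA [S / S]mulrC SV mulr1.
split=> [[_ [_ H0 eqH]] s Is | H].
  have S0 : \sum_k curvature2 (alpha k) (s 0 k) != 0.
    by rewrite -(edot_mean_curvature oI alphaP Is) edot_eq0 H0.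
  split=> // i; apply/eqS => //.
  by move/(soliton_equation_at oI alphaP Is): (eqH s Is); apply.
split.
  move=> s u v Is.
  have [_ ->] := curve_product_is_derive u (dalpha s Is).
  have [_ ->] := curve_product_is_derive v (dalpha s Is).
  rewrite /omega edot_rows; apply: big1 => i _.
  by rewrite edot_rV2 !mxE ?eqxx /=; ring.
split.
- split=> [k | s u Is].
    by apply: curve_product_Ck => // i; have [] := alphaP i.
  have [_ ->] := curve_product_is_derive u (dalpha s Is) => /matrixP u0.
  apply/rowP => i; rewrite mxE; apply/eqP.
  have [_ /(_ _ (Is i))] := alphaP i.
  apply: contraR => ui0; apply/eqP/rowP => j; apply/eqP.
  by have := u0 i j; rewrite !mxE => /eqP; rewrite mulf_eq0 (negbTE ui0).
- move=> s Is; rewrite -edot_eq0 (edot_mean_curvature oI alphaP Is).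
  by have [] := H s Is.
move=> s Is; apply/(soliton_equation_at oI alphaP Is) => i.
by have [S0 E] := H s Is; apply/eqS.
Qed.
End SolitonEquation.

(** * Lines and circles *)

Section PlaneCurveAnalysis.
Context {R : realType}.
Implicit Types (c f g : R -> 'rV[R]_2) (U : set R) (t : R).

Lemma is_derive_edot f g t (df dg : 'rV[R]_2) :
  is_derive t 1 f df -> is_derive t 1 g dg ->
  is_derive t 1 (fun x => edot (f x) (g x)) (edot df (g t) + edot (f t) dg).
Proof.
move=> /is_derive_mxP Df /is_derive_mxP Dg.
have -> : (fun x => edot (f x) (g x)) =
    (fun x : R => f x 0 0) * (fun x : R => g x 0 0) +
    (fun x : R => f x 0 1) * (fun x : R => g x 0 1) :> (R -> R).
  by apply/funext => x; rewrite edot_rV2.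
have := is_deriveD (is_deriveM (Df 0 0) (Dg 0 0)) (is_deriveM (Df 0 1) (Dg 0 1)).
move/is_derive_eq; apply.
by rewrite !edot_rV2 /GRing.scale /=; ring.
Qed.

Lemma is_derive_cJ f t (df : 'rV[R]_2) :
  is_derive t 1 f df -> is_derive t 1 (fun x => cJ (f x)) (cJ df).
Proof.
move=> /is_derive_mxP Df; apply/is_derive_mxP => i j; rewrite !mxE.
have -> : (fun x => cJ (f x) i j) =
    if j == 0 then - (fun x => f x i 1) else (fun x => f x i 0).
  by apply/funext => x; rewrite mxE; case: ifP.
by case: ifP => _; [apply: is_deriveN; exact: Df | exact: Df].
Qed.

Lemma edotDC (b u : 'rV[R]_2) : edot b u + edot u b = 2 * edot u b.
Proof. by rewrite edotC; ring. Qed.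

Lemma edot_cJ_id (u : 'rV[R]_2) : edot u (cJ u) = 0.
Proof. by rewrite !planeE; ring. Qed.

Lemma edot_cJ_real (u v : 'rV[R]_2) :
  u 0 1 = 0 -> v 0 1 = 0 -> edot u (cJ v) = 0.
Proof. by rewrite !planeE => -> ->; ring. Qed.

(* The next four identities expand products in the frame [u], [cJ u]. *)
Lemma edot_frame (b u v : 'rV[R]_2) :
  edot b v * edot u u = edot u b * edot u v + edot b (cJ u) * edot (cJ u) v.
Proof. by rewrite !planeE; ring. Qed.

Lemma edot_cJ_sqr (x u : 'rV[R]_2) :
  edot x (cJ u) ^+ 2 = edot x x * edot u u - edot x u ^+ 2.
Proof. by rewrite !planeE; ring. Qed.

Lemma edot_cJ_mul (b u x : 'rV[R]_2) :
  edot b (cJ u) * edot x (cJ u) = edot u u * edot x b - edot u b * edot x u.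
Proof. by rewrite !planeE; ring. Qed.

Lemma edot_cJ_frame (b u x : 'rV[R]_2) :
  edot x (cJ b) * edot u u = edot x (cJ u) * edot u b - edot x u * edot b (cJ u).
Proof. by rewrite !planeE; ring. Qed.

Section RegularCurve.
Variables (U : set R) (c : R -> 'rV[R]_2).
Hypothesis cP : regular_curve U c.

Lemma regular_is_derive t : U t -> is_derive t 1 c (derive1 c t).
Proof. by move=> Ut; apply/derivable1_is_derive/(cP.1 0%N). Qed.

Lemma regular_is_derive2 t : U t -> is_derive t 1 (derive1 c) (derive1n 2 c t).
Proof. by move=> Ut; apply/derivable1_is_derive/(cP.1 1%N). Qed.

Lemma regular_speed2_gt0 t : U t -> 0 < speed2 c t.
Proof. by move=> Ut; apply/speed2_gt0/(cP.2 _ Ut). Qed.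

Lemma is_derive_speed2 t : U t ->
  is_derive t 1 (speed2 c) (2 * edot (derive1 c t) (derive1n 2 c t)).
Proof.
move=> Ut; have D := regular_is_derive2 Ut.
exact: is_derive_eq (is_derive_edot D D) (edotDC _ _).
Qed.

Lemma is_derive_support t : U t ->
  is_derive t 1 (support c) (edot (c t) (cJ (derive1n 2 c t))).
Proof.
move=> Ut; apply: is_derive_eq.
  exact: (is_derive_edot (regular_is_derive Ut) (is_derive_cJ (regular_is_derive2 Ut))).
by rewrite edot_cJ_id add0r.
Qed.

Lemma is_derive_edot_cst (v : 'rV[R]_2) f t (df : 'rV[R]_2) :
  is_derive t 1 f df -> is_derive t 1 (fun x => edot (f x) v) (edot df v).
Proof.
move=> Df; apply: is_derive_eq; first exact: (is_derive_edot Df (is_derive_cst v t 1)).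
by rewrite !edot_rV2 !mxE; ring.
Qed.

(* The angle of the velocity is constant: [<c', J c'(t0)>^2 / |c'|^2] has
   derivative zero by [<c'', v> |c'|^2 = <c'', c'> <c', v> + <c'', J c'> <J c', v>]. *)
Lemma straight_through_origin : is_interval U ->
  (forall t, U t -> turning c t = 0) -> (forall t, U t -> support c t = 0) ->
  forall t0 t, U t0 -> U t -> edot (c t) (cJ (derive1 c t0)) = 0.
Proof.
move=> iU X0 P0 t0 t U0 Ut; set v := cJ _.
pose g x := edot (derive1 c x) v.
have Dg x : U x -> is_derive x 1 g (edot (derive1n 2 c x) v).
  by move=> Ux; apply: is_derive_edot_cst; exact: regular_is_derive2.
have g0 x : U x -> g x = 0.
  move=> Ux; pose h y := g y ^+ 2 / speed2 c y.
  have Dh y : U y -> is_derive y 1 h 0.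
    move=> Uy; have w0 := regular_speed2_gt0 Uy.
    have w0' : speed2 c y != 0 by rewrite gt_eqF.
    have := is_deriveM (is_deriveX 2 (Dg y Uy)) (is_deriveV w0' (is_derive_speed2 Uy)).
    have -> : h = g ^+ 2 * (fun x => (speed2 c x)^-1) :> (R -> R).
      by apply/funext => x'; rewrite /h !fctE.
    move/is_derive_eq; apply.
    have Xy : edot (derive1n 2 c y) (cJ (derive1 c y)) = 0 := X0 y Uy.
    have bv : edot (derive1n 2 c y) v * speed2 c y =
        edot (derive1 c y) (derive1n 2 c y) * g y.
      by apply: etrans (edot_frame _ _ _) _; rewrite Xy mul0r addr0.
    rewrite /GRing.scale /= fctE expr1.
    transitivity (2 * g y / speed2 c y ^+ 2 * (edot (derive1n 2 c y) v * speed2 c y -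
      edot (derive1 c y) (derive1n 2 c y) * g y)); first by field.
    by rewrite bv subrr mulr0.
  have := interval_cst iU Dh Ux U0.
  rewrite /h /g [edot (derive1 c t0) v]edot_cJ_id expr0n mul0r => /eqP.
  rewrite mulf_eq0 sqrf_eq0 invr_eq0.
  by rewrite (gt_eqF (regular_speed2_gt0 Ux)) orbF => /eqP.
(* By [g0] this function is constant, and its value at [t0] is [support c t0], which is zero. *)
have := interval_cst (f := fun x => edot (c x) v) iU _ Ut U0.
rewrite (P0 _ U0 : edot (c t0) v = 0); apply => x Ux.
have := is_derive_edot_cst v (regular_is_derive Ux).
by rewrite -/(g x) g0.
Qed.

Lemma orthogonal_support2 t : edot (c t) (derive1 c t) = 0 ->
  support c t ^+ 2 = edot (c t) (c t) * speed2 c t.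
Proof. by move=> Q; rewrite /support edot_cJ_sqr Q expr0n subr0. Qed.

(** Differentiating [<c, c'> = 0] gives [<c, c''> = - |c'|^2], which is inserted in the expansion of
    [<c'', J c'> <c, J c'>]. *)
Lemma orthogonal_turning t : open U ->
  (forall t, U t -> edot (c t) (derive1 c t) = 0) -> U t ->
  turning c t * support c t = - speed2 c t ^+ 2.
Proof.
move=> oU Q Ut.
have /eqP := is_derive_near_cst oU Q Ut
  (is_derive_edot (regular_is_derive Ut) (regular_is_derive2 Ut)).
rewrite -/(speed2 c t) addrC addr_eq0 => /eqP dQ.
rewrite /turning /support edot_cJ_mul Q // mulr0 subr0 dQ -/(speed2 c t).
by rewrite mulrN expr2.
Qed.

Lemma circle_orthogonal (r : R) : open U ->
  (forall t, U t -> edot (c t) (c t) = r) ->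
  forall t, U t -> edot (c t) (derive1 c t) = 0.
Proof.
move=> oU rc t Ut; have D := regular_is_derive Ut.
have := is_derive_near_cst oU rc Ut (is_derive_edot D D).
by rewrite edotC; lra.
Qed.

(** The tangent lines stay at constant distance from the origin. With [q = <c, c'>] and
    [m = <c', c''>], differentiating [P^2 = k w] gives [P P' = k m], hence [P P' w = P^2 m]; the
    frame identity [P' w = P m - q X] then leaves [P q X = 0]. *)
Lemma support_speed_orthogonal (k : R) : open U ->
  (forall t, U t -> support c t ^+ 2 = k * speed2 c t) ->
  forall t, U t -> turning c t != 0 -> support c t != 0 ->
  edot (c t) (derive1 c t) = 0.
Proof.
move=> oU Pk t Ut X0 P0.
have E x : U x -> support c x ^+ 2 - k * speed2 c x = 0.
  by move=> Ux; rewrite Pk // subrr.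
have D : is_derive t 1 (fun x => support c x ^+ 2 - k * speed2 c x)
  (2 * support c t * edot (c t) (cJ (derive1n 2 c t)) -
   k * (2 * edot (derive1 c t) (derive1n 2 c t))).
  have -> : (fun x => support c x ^+ 2 - k * speed2 c x) =
      support c ^+ 2 - k *: speed2 c :> (R -> R).
    by apply/funext => x; rewrite !fctE.
  have := is_deriveB (is_deriveX 2 (is_derive_support Ut)) (is_deriveZ k (is_derive_speed2 Ut)).
  by move/is_derive_eq; apply; rewrite /GRing.scale /=; ring.
have dE := is_derive_near_cst oU E Ut D.
suff : support c t * edot (c t) (derive1 c t) * turning c t = 0.
  by move=> /eqP; rewrite !mulf_eq0 (negbTE X0) (negbTE P0) orbF => /eqP.
have := edot_cJ_frame (derive1n 2 c t) (derive1 c t) (c t).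
rewrite -/(turning c t) -/(speed2 c t) -/(support c t).
move: dE (Pk t Ut); move: (edot (c t) (derive1 c t)) (turning c t) => q x.
move: (edot (c t) _) (edot _ (derive1n 2 c t)) (support c t) (speed2 c t).
move=> p' m p v dE pk frame.
transitivity ((p ^+ 2 - k * v) * m - v / 2 * (2 * p * p' - k * (2 * m)) +
  p * (p' * v - (p * m - q * x))); first by field.
by rewrite dE pk frame; ring.
Qed.

Lemma real_line_turning_support : open U -> (forall t, U t -> c t 0 1 = 0) ->
  forall t, U t -> turning c t = 0 /\ support c t = 0.
Proof.
move=> oU c1.
have c1' t : U t -> derive1 c t 0 1 = 0.
  move=> Ut; have /is_derive_mxP/(_ 0 1) := regular_is_derive Ut.
  exact: is_derive_near_cst oU c1 Ut.
move=> t Ut; have c1'' : derive1n 2 c t 0 1 = 0.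
  have /is_derive_mxP/(_ 0 1) := regular_is_derive2 Ut.
  exact: is_derive_near_cst oU c1' Ut.
by split; apply: edot_cJ_real => //; [exact: c1' | exact: c1 | exact: c1'].
Qed.

End RegularCurve.
End PlaneCurveAnalysis.

(** * Similarities *)

Section LinearImages.
Context {R : realType}.

Lemma is_derive_linear (m p q r : nat) (L : {linear 'M[R]_(m, p) -> 'M[R]_(q, r)})
    (f : R -> 'M[R]_(m, p)) (df : 'M[R]_(m, p)) (t : R) :
  is_derive t 1 f df -> is_derive t 1 (fun x => L (f x)) (L df).
Proof.
move=> /is_derive_mxP Df; apply/is_derive_mxP => k l.
have LE (M : 'M[R]_(m, p)) : L M k l = \sum_i \sum_j M i j * L (delta_mx i j) k l.
  rewrite {1}[M]matrix_sum_delta linear_sum summxE; apply: eq_bigr => i _.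
  rewrite linear_sum summxE; apply: eq_bigr => j _.
  by rewrite linearZ mxE.
have -> : (fun x => L (f x) k l) =
    \sum_i \sum_j (L (delta_mx i j) k l *: (fun x => f x i j)) :> (R -> R).
  apply/funext => x; rewrite LE fct_sumE; apply: eq_bigr => i _.
  by rewrite fct_sumE; apply: eq_bigr => j _; rewrite mulrC.
rewrite LE; apply: is_derive_eq.
by apply: eq_bigr => i _; apply: eq_bigr => j _; rewrite mulrC.
Qed.

(** The derivatives of [L \o c] are known on [U] only, so the induction carries their values on [U]
    together with derivability; openness of [U] gives the next order. Injectivity of [L] keeps the
    velocity nonzero. *)
Lemma regular_curve_linear (L : {linear 'rV[R]_2 -> 'rV[R]_2}) (U : set R)
    (c : R -> 'rV[R]_2) :
  open U -> (forall v, L v = 0 -> v = 0) ->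
  regular_curve U c -> regular_curve U (fun t => L (c t)).
Proof.
move=> oU L0 [sc c0].
have DL k t : U t -> derive1n k (fun t => L (c t)) t = L (derive1n k c t) /\
    is_derive t 1 (derive1n k (fun t => L (c t))) (L (derive1n k.+1 c t)).
  elim: k t => [|k IHk] t Ut.
    split=> //; apply: is_derive_linear; exact/derivable1_is_derive/(sc 0%N).
  have E x : U x -> derive1n k.+1 (fun t => L (c t)) x = L (derive1n k.+1 c x).
    by move=> Ux; have [_ D] := IHk x Ux; rewrite derive1nS (is_derive1E D).
  split; first exact: E.
  have D : is_derive t 1 (fun x => L (derive1n k.+1 c x)) (L (derive1n k.+2 c t)).
    by apply: is_derive_linear; exact/derivable1_is_derive/(sc k.+1).
  apply: near_eq_is_derive D; apply: (open_near_eq oU) Ut => x Ux.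
  by rewrite E.
split=> [k t Ut | t Ut]; first by have [_ []] := DL k t Ut.
by apply: contra_neq (c0 t Ut) => e0; apply: L0; rewrite -e0; have [] := DL 1%N t Ut.
Qed.

End LinearImages.

(** * Varying one coordinate in a box, and the invariants of similar products *)

Section Boxes.
Context {R : realType} {n : nat}.
Implicit Types (s : 'rV[R]_n) (I : 'I_n -> set R).

Definition upd s (i : 'I_n) (t : R) : 'rV[R]_n :=
  \row_j (if j == i then t else s 0 j).

Lemma upd_same s i t : upd s i t 0 i = t.
Proof. by rewrite mxE eqxx. Qed.

Lemma upd_other s i t j : j != i -> upd s i t 0 j = s 0 j.
Proof. by rewrite mxE => /negbTE ->. Qed.

Lemma upd_box I s i t : box I s -> I i t -> box I (upd s i t).
Proof. by move=> Is It j; rewrite mxE; case: eqP => [->|_]. Qed.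

Lemma sum_upd (F : 'I_n -> R -> R) s i t :
  \sum_k F k (upd s i t 0 k) = F i t + \sum_(k < n | k != i) F k (s 0 k).
Proof.
rewrite (bigD1 i isT) /= upd_same; congr (_ + _).
by apply: eq_bigr => k ki; rewrite upd_other.
Qed.

Lemma box_nonempty I : (forall i, I i !=set0) -> exists s, box I s.
Proof.
move=> I0; exists (\row_i sval (cid (I0 i))) => i.
by rewrite mxE; exact: svalP (cid (I0 i)).
Qed.

Lemma edot_inrow (i : 'I_n) (u v : 'rV[R]_2) :
  edot (inrow i u) (inrow i v) = edot u v.
Proof. by rewrite edot_inrowr row_inrow eqxx. Qed.

Lemma cJ_inrow (i : 'I_n) (v : 'rV[R]_2) : cJ (inrow i v) = inrow i (cJ v).
Proof.
apply/matrixP => k j; rewrite !mxE; do ?case: ifP => //; by rewrite oppr0.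
Qed.

Lemma row_curve_product (gamma : 'I_n -> R -> 'rV[R]_2) s i :
  row i (curve_product gamma s) = gamma i (s 0 i).
Proof. by apply/rowP => j; rewrite !mxE. Qed.

Lemma is_derive_curve_product_upd (gamma : 'I_n -> R -> 'rV[R]_2) s
    (i : 'I_n) (t : R)
    (d : 'rV[R]_2) :
  is_derive t 1 (gamma i) d ->
  is_derive t 1 (fun x => curve_product gamma (upd s i x)) (inrow i d).
Proof.
move=> /is_derive_mxP D; apply/is_derive_mxP => k j; rewrite mxE.
have -> : (fun x => curve_product gamma (upd s i x) k j) =
    (if k == i then (fun x => gamma i x 0 j) else cst (gamma k (s 0 k) 0 j)) :> (R -> R).
  by apply/funext => x; rewrite !mxE; case: eqP => [->|].
by case: eqP => _; [exact: (D 0 j) | exact: is_derive_cst].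
Qed.

Lemma is_derive_inrow (i : 'I_n) (c : R -> 'rV[R]_2) (t : R)
    (d : 'rV[R]_2) :
  is_derive t 1 c d -> is_derive t 1 (fun x => inrow i (c x)) (inrow i d).
Proof.
move=> D; have := is_derive_curve_product_upd (gamma := only i c) 0 (i := i) (t := t) (d := d).
have -> : (fun x => curve_product (only i c) (upd 0 i x)) = (fun x => inrow i (c x)).
  by apply/funext => x; rewrite curve_product_only upd_same.
by apply; rewrite /only eqxx.
Qed.

Section Similarity.
Variables (I J : 'I_n -> set R) (alpha beta : 'I_n -> R -> 'rV[R]_2).
Variables (rho : R) (f : {linear 'M[R]_(n, 2) -> 'M[R]_(n, 2)}) (tau : 'S_n).
Hypothesis oI : forall i, open (I i).
Hypothesis I0 : forall i, I i !=set0.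
Hypothesis alphaP : forall i, regular_curve (I i) (alpha i).
Hypothesis JE : forall i, J i = I (tau i).
Hypothesis betaP : forall i, regular_curve (J i) (beta i).
Hypothesis fP : unitary f.
Hypothesis simE : forall s, box I s ->
  curve_product beta (col_perm tau s) = rho *: f (curve_product alpha s).

Lemma similar_invariants i t : I (tau i) t ->
  [/\ speed2 (beta i) t = rho ^+ 2 * speed2 (alpha (tau i)) t,
      turning (beta i) t = rho ^+ 2 * turning (alpha (tau i)) t &
      support (beta i) t = rho ^+ 2 * support (alpha (tau i)) t].
Proof.
have [b Ib] := box_nonempty I0; set k := tau i.
have updE x : col_perm tau (upd b k x) = upd (col_perm tau b) i x.
  by apply/rowP => j; rewrite !mxE (inj_eq perm_inj).
have sim x : I k x ->
    curve_product beta (upd (col_perm tau b) i x) =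
    rho *: f (curve_product alpha (upd b k x)).
  by move=> Ix; rewrite -updE simE //; exact: upd_box.
have L (F : R -> 'M[R]_(n, 2)) dF (x : R) : is_derive x 1 F dF ->
    is_derive x 1 (fun y => rho *: f (F y)) (rho *: f dF).
  by move=> D; apply: is_deriveZ; exact: is_derive_linear.
have uniq_der (F G : R -> 'M[R]_(n, 2)) dF dG (x : R) :
    (forall y, I k y -> F y = G y) -> I k x ->
    is_derive x 1 F dF -> is_derive x 1 G dG -> dF = dG.
  move=> FG Ix [_ <-] [_ <-]; apply: near_eq_derive.
  exact: (open_near_eq (@oI k)) FG Ix.
have d1 x : I k x ->
    inrow i (derive1 (beta i) x) = rho *: f (inrow k (derive1 (alpha k) x)).
  move=> Ix; apply: (uniq_der _ _ _ _ _ sim Ix).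
    apply: is_derive_curve_product_upd; apply: (regular_is_derive (@betaP i)).
    by rewrite JE; exact: Ix.
  apply: L; apply: is_derive_curve_product_upd.
  exact: (regular_is_derive (@alphaP k)).
have d2 x : I k x ->
    inrow i (derive1n 2 (beta i) x) = rho *: f (inrow k (derive1n 2 (alpha k) x)).
  move=> Ix; apply: (uniq_der _ _ _ _ _ d1 Ix).
    apply: is_derive_inrow; apply: (regular_is_derive2 (@betaP i)).
    by rewrite JE; exact: Ix.
  apply: L; apply: is_derive_inrow.
  exact: (regular_is_derive2 (@alphaP k)).
move=> It; have [fe fJ] := fP.
have eZ (u v : 'M[R]_(n, 2)) : edot (rho *: f u) (rho *: f v) = rho ^+ 2 * edot u v.
  rewrite -(fe u v) /edot !big_distrr /=; apply: eq_bigr => x _.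
  by rewrite big_distrr; apply: eq_bigr => y _; rewrite !mxE /=; ring.
have d1J : inrow i (cJ (derive1 (beta i) t)) =
    rho *: f (inrow k (cJ (derive1 (alpha k) t))).
  rewrite -!cJ_inrow d1 // fJ.
  by apply/matrixP => x y; rewrite !mxE; case: ifP; rewrite ?mulrN.
split.
- by rewrite /speed2 -(edot_inrow i) d1 // eZ edot_inrow.
- rewrite /turning; move: (derive1n 2 (beta i) t) (d2 t It) => b2 e2.
  by rewrite -(edot_inrow i) d1J e2 eZ edot_inrow.
(* The position vector has other nonzero rows, but its product with a vector supported in row [i]
   sees that row only. *)
rewrite /support -[beta i t](_ : row i (curve_product beta (upd (col_perm tau b) i t)) = _).
  by rewrite -edot_inrowr d1J sim // eZ edot_inrowr row_curve_product upd_same.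
by rewrite row_curve_product upd_same.
Qed.

End Similarity.
End Boxes.

(** * Rotations of the factors and their reordering *)

Section Rotation.
Context {R : realType}.
Implicit Types (u x y : 'rV[R]_2).

(* multiplication by the conjugate of the complex number [u] *)
Definition rot u x : 'rV[R]_2 :=
  \row_j (if j == 0 then edot x u else edot x (cJ u)).

Lemma rotE0 u x : rot u x 0 0 = edot x u.
Proof. by rewrite mxE. Qed.

Lemma rotE1 u x : rot u x 0 1 = edot x (cJ u).
Proof. by rewrite mxE. Qed.

Definition rotE := (rotE0, rotE1).

Lemma rot_is_linear u : linear (rot u).
Proof.
by move=> k x y; apply: rV2P; rewrite !mxE /= ?mxE !planeE !mxE; ring.
Qed.

HB.instance Definition _ u :=
  GRing.isLinear.Build R 'rV[R]_2 'rV[R]_2 _ (rot u) (rot_is_linear u).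

Lemma edot_rot u x y : edot u u = 1 -> edot (rot u x) (rot u y) = edot x y.
Proof.
move=> u1; rewrite -[RHS]mulr1 -u1 edot_rV2 !rotE !planeE; ring.
Qed.

Lemma rot_cJ u x : rot u (cJ x) = cJ (rot u x).
Proof. by apply: rV2P; rewrite ?cJ0 ?cJ1 !rotE !planeE; ring. Qed.

Lemma edotZ (k : R) x : edot (k *: x) (k *: x) = k ^+ 2 * edot x x.
Proof. by rewrite !edot_rV2 !mxE; ring. Qed.

Lemma unit_direction x : x != 0 -> exists2 u, edot u u = 1 &
  forall y, edot y (cJ x) = 0 -> edot y (cJ u) = 0.
Proof.
move=> x0; have N0 : 0 < edot x x by rewrite lt_def edot_eq0 x0 edot_ge0.
exists ((enorm x)^-1 *: x); first by rewrite edotZ exprVn enorm2 mulVf ?gt_eqF.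
move=> y; rewrite !planeE !mxE => yx.
by rewrite -[RHS](mulr0 (enorm x)^-1) -yx; ring.
Qed.

Section RowwiseRotation.
Variables (n : nat) (tau : 'S_n) (u : 'I_n -> 'rV[R]_2).

(** The congruence used for the models: a permutation of the coordinates of [C^n] combined with a
    rotation of each. *)
Definition rot_rows (M : 'M[R]_(n, 2)) : 'M[R]_(n, 2) :=
  \matrix_(i, j) rot (u (tau i)) (row (tau i) M) 0 j.

Lemma rot_rows_is_linear : linear rot_rows.
Proof.
move=> k x y; apply/matrixP => i j.
by rewrite /rot_rows mxE !linearP /= !mxE.
Qed.

HB.instance Definition _ :=
  GRing.isLinear.Build R 'M[R]_(n, 2) 'M[R]_(n, 2) _ rot_rows rot_rows_is_linear.

Lemma row_rot_rows M i : row i (rot_rows M) = rot (u (tau i)) (row (tau i) M).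
Proof. by apply/rowP => j; rewrite mxE /rot_rows mxE. Qed.

Lemma row_cJ (M : 'M[R]_(n, 2)) i : row i (cJ M) = cJ (row i M).
Proof. by apply/rowP => j; rewrite !mxE. Qed.

Lemma rot_rows_unitary : (forall i, edot (u i) (u i) = 1) -> unitary rot_rows.
Proof.
move=> u1; split=> [x y | x].
  rewrite !edot_rows [RHS](reindex_inj (@perm_inj _ tau)) /=.
  by apply: eq_bigr => i _; rewrite !row_rot_rows edot_rot.
by apply/row_matrixP => i; rewrite row_cJ !row_rot_rows row_cJ rot_cJ.
Qed.
End RowwiseRotation.
End Rotation.

(** Used to put the curved factors first: the elements of [A] are listed before those of its
    complement. *)
Lemma exists_sorting_perm n (A : {set 'I_n}) :
  exists tau : 'S_n, forall i : 'I_n, (tau i \in A) = (i < #|A|)%N.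
Proof.
pose e := enum A ++ enum (~: A).
have ue : uniq e.
  rewrite cat_uniq !enum_uniq /= andbT; apply/hasPn => x /=.
  by rewrite !mem_enum inE.
have se : size e = n by rewrite size_cat -!cardE cardsC card_ord.
(* The default [i] is never reached, since [e] has size [n]. *)
pose h (i : 'I_n) := nth i e i.
have hi : injective h.
  move=> i j /eqP; rewrite /h (set_nth_default i j) ?se //.
  by rewrite nth_uniq ?se // => /eqP /val_inj.
exists (perm hi) => i; rewrite permE /h /e nth_cat -cardE.
case: ltnP => iA.
  by rewrite -mem_enum mem_nth // -cardE.
apply/negbTE; have : nth i (enum (~: A)) (i - #|A|) \in enum (~: A).
  by apply: mem_nth; rewrite -cardE -(ltn_add2l #|A|) subnKC // cardsC card_ord.
by rewrite mem_enum inE.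
Qed.

Section Invariants.
Context {R : realType}.
Implicit Types (c : R -> 'rV[R]_2) (U : set R).

(** Multiplication by [|c'|^3] clears the square roots, and the sign comes from
    [<c', J c> = - <c, J c'>]. *)
Lemma icsf_solitonP (a : R) U c : regular_curve U c ->
  icsf_soliton a U c <->
  (forall t, U t -> a * (turning c t * support c t) = - speed2 c t ^+ 2).
Proof.
move=> cP.
have E t : U t -> (a * signed_curvature c t * edot (derive1 c t) (cJ (c t)) =
     enorm (derive1 c t)) <-> (a * (turning c t * support c t) = - speed2 c t ^+ 2).
  move=> Ut; have w0 := regular_speed2_gt0 cP Ut.
  rewrite /signed_curvature -/(turning c t).
  have -> : edot (derive1 c t) (cJ (c t)) = - support c t.
    by rewrite /support !planeE; ring.
  have <- : enorm (derive1 c t) ^+ 2 = speed2 c t by rewrite enorm2.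
  have : enorm (derive1 c t) != 0.
    by apply/eqP => N0; move: w0; rewrite /speed2 -enorm2 N0 expr0n ltxx.
  move: (enorm _) (turning c t) (support c t) => N X P N0; split=> e.
    transitivity (- (a * (X / N ^+ 3) * - P) * N ^+ 3); first by field.
    by rewrite e; ring.
  transitivity (- (a * (X * P)) / N ^+ 3); first by field.
  by rewrite e; field.
by split=> H t Ut; apply/E => //; exact: H.
Qed.

End Invariants.

(** * Solutions of the soliton equation *)

Section SeparatedEquation.
Context {R : realType}.
Variables (n : nat) (a : R) (I : 'I_n -> set R) (w X P K : 'I_n -> R -> R).
Hypothesis a0 : a != 0.
Hypothesis I0 : forall i, I i !=set0.
Hypothesis w_gt0 : forall i t, I i t -> 0 < w i t.
Hypothesis KE : forall i t, K i t = X i t ^+ 2 / w i t ^+ 3.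
Local Notation S s := (\sum_k K k (s 0 k)).
Hypothesis solP : separated_equation a I w X P K.

(** Equation [i] at [ti] has a nonzero left side, so [a * P i ti] is nonzero and [S] is determined;
    moving the coordinate [j] changes only the term [K j] of [S]. *)
Lemma other_curvatures_cst i ti j t t' : I i ti -> X i ti != 0 -> j != i ->
  I j t -> I j t' -> K j t = K j t'.
Proof.
move=> Ii Xi ji It It'.
have [b Ib] := box_nonempty I0.
have ij : i != j by rewrite eq_sym.
have Ib' : box I (upd b i ti) by exact: upd_box.
have Sj y : I j y -> - X i ti / w i ti = a * P i ti * S (upd (upd b i ti) j y).
  move=> Iy; have [_ /(_ i)] := solP (upd_box Ib' Iy).
  by rewrite (upd_other _ _ ij) upd_same => ->.
have aP0 : a * P i ti != 0.
  apply: contraNneq Xi => aP0; move: (Sj t It).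
  rewrite aP0 mul0r => /eqP.
  by rewrite mulf_eq0 oppr_eq0 invr_eq0 (gt_eqF (w_gt0 Ii)) orbF.
have Sup y : S (upd (upd b i ti) j y) =
    K j y + \sum_(l < n | l != j) K l (upd b i ti 0 l).
  exact: sum_upd.
have := mulfI aP0 (etrans (esym (Sj t It)) (Sj t' It')).
by rewrite (Sup t) (Sup t') => /addIr.
Qed.

(** The factors whose curvature is not identically zero. *)
Definition curved : {set 'I_n} :=
  [set i | `[< exists2 t, I i t & X i t != 0 >]].

(** Where [X] vanishes the equation reads [0 = a P S], with [a] and [S] nonzero. *)
Lemma not_curved i t : i \notin curved -> I i t -> X i t = 0 /\ P i t = 0.
Proof.
rewrite inE => /asboolPn nA It.
have X0 : X i t = 0 by apply/eqP; apply: contra_notT nA => X0; exists t.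
have [b Ib] := box_nonempty I0.
have [S0 /(_ i)] := solP (upd_box Ib It).
rewrite upd_same X0 oppr0 mul0r => /esym /eqP.
by rewrite !mulf_eq0 (negbTE a0) (negbTE S0) orbF /= => /eqP.
Qed.

Lemma not_curved_curvature i t : i \notin curved -> I i t -> K i t = 0.
Proof. by move=> iA It; rewrite KE (not_curved iA It).1 expr0n mul0r. Qed.

Lemma sum_curved s : box I s -> S s = \sum_(k in curved) K k (s 0 k).
Proof.
move=> Is; rewrite [RHS]big_mkcond; apply: eq_bigr => i _.
by case: ifPn => // iA; exact: not_curved_curvature.
Qed.

Lemma curved_gt0 : (0 < #|curved|)%N.
Proof.
have [b Ib] := box_nonempty I0; have [S0 _] := solP Ib.
rewrite card_gt0; apply: contraNneq S0 => A0.
by rewrite sum_curved // A0 big_set0.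
Qed.

(** Here [S] is the single term [X^2 / w^3]; it is nonzero, so [X] can be cancelled in
    [- X / w = a P X^2 / w^3]. *)
Lemma curved1 i t : (#|curved| = 1)%N -> i \in curved -> I i t ->
  a * (X i t * P i t) = - w i t ^+ 2.
Proof.
move=> /eqP/cards1P[i0 Ai0]; rewrite Ai0 inE => /eqP -> It.
have [b Ib] := box_nonempty I0; have Is := upd_box Ib It.
have [S0 /(_ i0)] := solP Is.
move: S0; rewrite sum_curved // Ai0 big_set1 upd_same KE.
have := w_gt0 It; move: (X _ _) (P _ _) (w _ _) => x p v v0.
rewrite mulf_eq0 negb_or sqrf_eq0 => /andP[x0 _] e.
have vn0 : v != 0 by rewrite gt_eqF.
transitivity ((a * p * (x ^+ 2 / v ^+ 3)) * v ^+ 3 / x); first by field; rewrite vn0 x0.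
by rewrite -e; field; rewrite vn0 x0.
Qed.

(** The first hypothesis is the only geometric input: a constant ratio [P^2 / w] forces
    [X P = - w^2]. The number [r] will be the common squared radius of the circles. *)
Lemma curved_ge2 :
  (forall i k,
    (forall t, I i t -> [/\ P i t ^+ 2 = k * w i t, X i t != 0 & P i t != 0]) ->
    forall t, I i t -> X i t * P i t = - w i t ^+ 2) ->
  (1 < #|curved|)%N ->
  exists2 r, 0 < r & a = #|curved|%:R^-1 /\
    forall i t, i \in curved -> I i t ->
    [/\ P i t ^+ 2 = r * w i t, X i t != 0 & P i t != 0].
Proof.
move=> geo A2; have [b Ib] := box_nonempty I0.
(* With at least two curved factors, every [j] has a curved factor other than itself, whose equation
   fixes [K j]. *)
have Kcst j t t' : I j t -> I j t' -> K j t = K j t'.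
  have : curved :\ j != finset.set0.
    rewrite -card_gt0; move: A2; rewrite (cardsD1 j).
    by case: (j \in curved) => //= /ltnW.
  case/finset.set0Pn => i; rewrite !inE => /andP[ij /asboolP[ti Ii Xi]].
  by apply: (other_curvatures_cst Ii Xi); rewrite eq_sym.
pose S0 := S b.
have SE s : box I s -> S s = S0.
  by move=> Is; apply: eq_bigr => i _; exact: Kcst (Is i) (Ib i).
have S00 : S0 != 0 by have [] := solP Ib.
have eqn i t : I i t -> - X i t / w i t = a * P i t * S0.
  move=> It; have Is := upd_box Ib It.
  by have [_ /(_ i)] := solP Is; rewrite SE // upd_same.
have XE i t : I i t -> X i t = - (a * P i t * S0 * w i t).
  move=> It; rewrite -(eqn i t It) mulfVK ?opprK // gt_eqF //; exact: w_gt0.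
have Xn0 i t : i \in curved -> I i t -> X i t != 0.
  rewrite inE => /asboolP[ti Ii Xi] It.
  have : K i t != 0.
    rewrite (Kcst i t ti It Ii) KE mulf_neq0 ?invr_eq0 ?expf_neq0 //.
    by rewrite gt_eqF //; exact: w_gt0.
  by rewrite KE mulf_eq0 sqrf_eq0 => /norP[].
have Pn0 i t : i \in curved -> I i t -> P i t != 0.
  move=> iA It; apply: contraNneq (Xn0 i t iA It) => P0.
  by rewrite XE // P0 mulr0 !mul0r oppr0.
have PK i t : I i t -> K i t * w i t = a ^+ 2 * S0 ^+ 2 * P i t ^+ 2.
  move=> It; rewrite KE XE //; field.
  by rewrite gt_eqF //; exact: w_gt0.
(* As [K i] is constant, [PK] makes [P^2] a constant multiple of [w], so [X P = - w^2]; then [X] is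
   replaced by its value [XE]. *)
have wE i t : i \in curved -> I i t -> a * S0 * P i t ^+ 2 = w i t.
  move=> iA It; have w0 : w i t != 0 by rewrite gt_eqF // w_gt0.
  apply: (mulIf w0); apply: oppr_inj; rewrite -[w i t * w i t]expr2.
  rewrite -(geo i (K i (b 0 i) / (a ^+ 2 * S0 ^+ 2)) _ t It).
    by rewrite XE //; ring.
  move=> x Ix; split; [|exact: Xn0|exact: Pn0].
  rewrite (Kcst i _ x (Ib i) Ix) mulrAC PK // mulrC mulKf //.
  by rewrite mulf_neq0 ?expf_neq0.
have aS0 : a * S0 != 0 by rewrite mulf_neq0.
have PE i t : i \in curved -> I i t -> P i t ^+ 2 = (a * S0)^-1 * w i t.
  by move=> iA It; rewrite -(wE i t iA It) mulKf.
exists (a * S0)^-1.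
  have /card_gt0P[i iA] := curved_gt0.
  have wb := w_gt0 (Ib i); rewrite -(pmulr_lgt0 _ wb) -(PE i) //.
  by rewrite lt_def sqrf_eq0 sqr_ge0 Pn0.
split; last by move=> i t iA It; split; [exact: PE | exact: Xn0 | exact: Pn0].
(* By [PK] and [wE] each curved factor has squared curvature [a * S0]; summing them gives
   [a * #|curved| = 1]. *)
have : S0 = (a * S0) *+ #|curved|.
  rewrite -sumr_const {1}/S0 sum_curved //; apply: eq_bigr => i iA.
  have w0 : w i (b 0 i) != 0 by rewrite gt_eqF // w_gt0.
  by apply: (mulIf w0); rewrite PK // -(wE i) //; ring.
rewrite -mulr_natr mulrAC -[LHS]mul1r => /(mulIf S00) e.
have k0 : #|curved|%:R != 0 :> R by rewrite pnatr_eq0 -lt0n curved_gt0.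
by apply: (mulIf k0); rewrite -e mulVf.
Qed.

End SeparatedEquation.

(** * The models satisfy the soliton equation *)

Section Converse.
Context {R : realType}.
Implicit Types (c : R -> 'rV[R]_2) (U : set R).

Lemma unit_circle_invariants U c : open U -> regular_curve U c ->
  in_unit_circle U c -> forall t, U t ->
  curvature2 c t = 1 /\ - turning c t / speed2 c t = support c t.
Proof.
move=> oU cP c1 t Ut.
have e1 x : U x -> edot (c x) (c x) = 1 by move=> Ux; rewrite -enorm2 c1 ?expr1n.
have Q := circle_orthogonal cP oU e1.
have := orthogonal_turning cP oU Q Ut; have := orthogonal_support2 (Q t Ut).
rewrite e1 // mul1r /curvature2; have := regular_speed2_gt0 cP Ut.
move: (turning c t) (support c t) (speed2 c t) => x p v /lt0r_neq0 v0 ev XP.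
have p0 : p != 0 by rewrite -sqrf_eq0 ev.
(* From [p^2 = v] and [x p = - v^2], whatever the orientation of the circle. *)
have -> : x = - p ^+ 3.
  by apply: (mulIf p0); rewrite XP -ev; ring.
by rewrite -ev; split; field.
Qed.

Lemma sum_lt_ord (n k : nat) : (k <= n)%N ->
  \sum_(i < n) (if (i < k)%N then 1 else 0) = k%:R :> R.
Proof.
move=> kn; rewrite -big_mkcond /= -(big_ord_widen _ (fun=> 1) kn).
by rewrite sumr_const card_ord.
Qed.

Section Models.
Variables (n : nat) (a : R) (J : 'I_n -> set R) (beta : 'I_n -> R -> 'rV[R]_2).
Hypothesis oJ : forall i, open (J i).
Hypothesis betaP : forall i, regular_curve (J i) (beta i).

Lemma circles_lines_solution (k : nat) : (0 < k <= n)%N -> a = k%:R^-1 ->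
  (forall i : 'I_n, (i < k)%N -> in_unit_circle (J i) (beta i)) ->
  (forall i : 'I_n, (k <= i)%N -> in_real_line (J i) (beta i)) ->
  product_equation a J beta.
Proof.
move=> /andP[k0 kn] ak circ line s Js; set S := \sum_l _.
have L (i : 'I_n) : (k <= i)%N ->
    turning (beta i) (s 0 i) = 0 /\ support (beta i) (s 0 i) = 0.
  by move=> ki; exact: (real_line_turning_support (@betaP i) (@oJ i) (line i ki) (Js i)).
have C (i : 'I_n) (ik : (i < k)%N) :=
  unit_circle_invariants (@oJ i) (@betaP i) (circ i ik) (Js i).
have -> : S = k%:R.
  rewrite -(sum_lt_ord kn); apply: eq_bigr => i _; case: ltnP => ik.
    by case: (C i ik).
  by rewrite /curvature2 (L i ik).1 expr0n mul0r.
have kn0 : k%:R != 0 :> R by rewrite pnatr_eq0 -lt0n.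
split=> // i; case: (ltnP i k) => ik.
  by rewrite (C i ik).2 ak mulrAC mulVf // mul1r.
by rewrite (L i ik).1 (L i ik).2 oppr0 !(mul0r, mulr0).
Qed.

(** Only [beta i0] contributes to the sum; its curvature is nonzero, as the right side of its own
    soliton equation is. *)
Lemma icsf_lines_solution (i0 : 'I_n) : icsf_soliton a (J i0) (beta i0) ->
  (forall i, i != i0 -> in_real_line (J i) (beta i)) ->
  product_equation a J beta.
Proof.
move=> /(icsf_solitonP _ (@betaP i0)) icsf line s Js; set S := \sum_l _.
have L i : i != i0 -> turning (beta i) (s 0 i) = 0 /\ support (beta i) (s 0 i) = 0.
  by move=> ki; exact: (real_line_turning_support (@betaP i) (@oJ i) (line i ki) (Js i)).
have -> : S = curvature2 (beta i0) (s 0 i0).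
  rewrite /S (bigD1 i0) //= big1 ?addr0 // => i ii0.
  by rewrite /curvature2 (L i ii0).1 expr0n mul0r.
have [w0 e] : speed2 (beta i0) (s 0 i0) != 0 /\
    a * (turning (beta i0) (s 0 i0) * support (beta i0) (s 0 i0)) =
    - speed2 (beta i0) (s 0 i0) ^+ 2.
  split; last exact: icsf.
  by rewrite gt_eqF //; exact: (regular_speed2_gt0 (@betaP i0) (Js i0)).
have x0 : turning (beta i0) (s 0 i0) != 0.
  apply: contraNneq w0 => x0; move/eqP: e.
  by rewrite x0 mul0r mulr0 eq_sym oppr_eq0 sqrf_eq0.
split; first by rewrite /curvature2 mulf_neq0 ?invr_eq0 ?expf_neq0.
move=> i; case: (eqVneq i i0) => [-> | /L[-> ->]]; last first.
  by rewrite oppr0 !(mul0r, mulr0).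
rewrite /curvature2; move: e w0 x0.
move: (turning _ _) (support _ _) (speed2 _ _) => x p v e v0 x0.
transitivity (a * (x * p) * x / v ^+ 3); last by field.
by rewrite e; field.
Qed.

End Models.
End Converse.

(** * Invariance of the soliton equation under similarities *)

Section Transfer.
Context {R : realType}.
Variables (n : nat) (a : R).
Variables (I J : 'I_n -> set R) (alpha beta : 'I_n -> R -> 'rV[R]_2).
Hypothesis hI : forall i, open_interval (I i).
Hypothesis alphaP : forall i, regular_curve (I i) (alpha i).
Hypothesis betaP : forall i, regular_curve (J i) (beta i).

(** The quotient of [turning] by [speed2] is unchanged, while [support] is multiplied by [rho ^+ 2]
    and the squared curvatures are divided by it. *)
Lemma similar_solution : similar_products I alpha J beta ->
  product_equation a J beta -> product_equation a I alpha.
Proof.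
case=> rho [f [tau [rho0 fP JE simE]]] solb s Is; set S := \sum_l _.
have oI i : open (I i) by case: (hI i).
have I0 i : I i !=set0 by case: (hI i).
pose inv i := similar_invariants oI I0 alphaP JE betaP fP simE (i := i) (Is (tau i)).
have r0 : rho != 0 by rewrite gt_eqF.
have w0 i : speed2 (alpha i) (s 0 i) != 0.
  by rewrite gt_eqF //; exact: (regular_speed2_gt0 (@alphaP i) (Is i)).
have Js : box J (col_perm tau s) by move=> i; rewrite JE mxE; exact: Is.
have [] := solb _ Js.
have -> : \sum_k curvature2 (beta k) (col_perm tau s 0 k) = S / rho ^+ 2.
  rewrite /S big_distrl [RHS](reindex_inj (@perm_inj _ tau)) /=.
  apply: eq_bigr => i _; have [W X _] := inv i.
  by rewrite mxE /curvature2 W X; field; rewrite r0 w0.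
rewrite mulf_eq0 negb_or => /andP[S0 _] eqb; split=> // i.
have := eqb (tau^-1 i)%g; rewrite mxE permKV.
have := inv (tau^-1 i)%g; rewrite permKV => -[-> -> ->] e.
transitivity (- (rho ^+ 2 * turning (alpha i) (s 0 i)) /
  (rho ^+ 2 * speed2 (alpha i) (s 0 i))); first by field; rewrite r0 w0.
by rewrite e; field.
Qed.

End Transfer.

(** * Reduction of a soliton to the models *)

Section Direct.
Context {R : realType}.
Variables (n : nat) (a : R) (I : 'I_n -> set R) (alpha : 'I_n -> R -> 'rV[R]_2).
Hypothesis a0 : a != 0.
Hypothesis hI : forall i, open_interval (I i).
Hypothesis alphaP : forall i, regular_curve (I i) (alpha i).
Hypothesis solP : product_equation a I alpha.
Local Notation A := (curved I (fun i => turning (alpha i))).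

Let I0 i : I i !=set0. Proof. by case: (hI i). Qed.

Let w_gt0 i t : I i t -> 0 < speed2 (alpha i) t.
Proof. exact: (regular_speed2_gt0 (@alphaP i)). Qed.

(** Rotating by [u i] leaves a curved factor unchanged and brings a straight one, which lies on a
    line through the origin, onto the real axis. *)
Lemma exists_directions : exists u : 'I_n -> 'rV[R]_2, forall i,
  [/\ edot (u i) (u i) = 1,
      i \in A -> u i = delta_mx 0 0 &
      i \notin A -> forall t, I i t -> edot (alpha i t) (cJ (u i)) = 0].
Proof.
suff /choice[u uP] : forall i, exists u, [/\ edot u u = 1,
    i \in A -> u = delta_mx 0 0 &
    i \notin A -> forall t, I i t -> edot (alpha i t) (cJ u) = 0] by exists u.
move=> i.
case: (boolP (i \in A)) => iA.
  by exists (delta_mx 0 0); split=> //; rewrite edot_rV2 !mxE /=; ring.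
have [_ iI [t0 It0]] := hI i.
have [u u1 uP] := unit_direction ((alphaP i).2 t0 It0).
exists u; split=> // _ t It; apply: uP.
by apply: (straight_through_origin (alphaP i) iI _ _ It0 It) => x Ix;
  have [] := not_curved a0 I0 solP iA Ix.
Qed.

Lemma rot_e1 (x : 'rV[R]_2) : rot (delta_mx 0 0) x = x.
Proof. by apply: rV2P; rewrite rotE !planeE !mxE /=; ring. Qed.

Lemma similar_to_rotation (rho : R) (tau : 'S_n) (u : 'I_n -> 'rV[R]_2) :
  0 < rho -> (forall i, edot (u i) (u i) = 1) ->
  let J := fun i => I (tau i) in
  let beta := fun i t => rho *: rot (u (tau i)) (alpha (tau i) t) in
  similar_products I alpha J beta /\ (forall i, regular_curve (J i) (beta i)).
Proof.
move=> rho0 u1 J beta; split.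
  exists rho, (rot_rows tau u), tau; split=> //; first exact: rot_rows_unitary.
  move=> s Is; apply/row_matrixP => i.
  by rewrite linearZ /= row_rot_rows !row_curve_product mxE.
move=> i; have [oI _ _] := hI (tau i).
apply: (@regular_curve_linear _ (rho \*: rot (u (tau i))) _ _ oI) => // v /= v0.
apply/eqP; rewrite -edot_eq0 -(edot_rot v v (u1 (tau i))) edot_eq0.
by move/eqP: v0; rewrite scaler_eq0 gt_eqF.
Qed.

Lemma solution_curved1 (i : 'I_n) : (#|A| = 1)%N -> i \in A ->
  icsf_soliton a (I i) (alpha i).
Proof.
move=> A1 iA; apply/(icsf_solitonP _ (@alphaP i)) => t It.
exact: (curved1 a0 I0 w_gt0 (fun _ _ => erefl) solP A1 iA It).
Qed.

Lemma solution_curved_ge2 : (1 < #|A|)%N ->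
  exists2 r, 0 < r & a = #|A|%:R^-1 /\
    forall i t, i \in A -> I i t -> edot (alpha i t) (alpha i t) = r.
Proof.
have Q i k : (forall t, I i t -> [/\ support (alpha i) t ^+ 2 = k * speed2 (alpha i) t,
      turning (alpha i) t != 0 & support (alpha i) t != 0]) ->
    forall t, I i t -> edot (alpha i t) (derive1 (alpha i) t) = 0.
  move=> H t It; have [oI _ _] := hI i; have [_ X0 P0] := H t It.
  apply: (support_speed_orthogonal (@alphaP i) oI _ It X0 P0 (k := k)) => x Ix.
  by have [] := H x Ix.
move=> A2; have [|r r0 [ak rP]] := curved_ge2 a0 I0 w_gt0 (fun _ _ => erefl) solP _ A2.
  move=> i k H t It; have [oI _ _] := hI i.
  exact: (orthogonal_turning (@alphaP i) oI (Q i k H) It).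
exists r => //; split=> // i t iA It.
have Qi := Q i r (fun t => rP i t iA) t It.
(* By orthogonality [P^2] is also [<alpha, alpha>] times [w], so the ratio [r] is the squared
   radius. *)
have [Pr _ _] := rP i t iA It; apply: (mulIf (lt0r_neq0 (w_gt0 It))).
by rewrite -Pr orthogonal_support2.
Qed.

End Direct.

Theorem proposition4p1 (R : realType) (n : nat) (a : R)
    (I : 'I_n -> set R) (alpha : 'I_n -> R -> 'rV[R]_2)
    (hn : (0 < n)%N) (ha : a != 0)
    (hI : forall i, open_interval (I i))
    (halpha : forall i, regular_curve (I i) (alpha i)) :
  (lagrangian (box I) (curve_product alpha) /\
   imcf_soliton a (box I) (curve_product alpha))
  <->
  (exists (J : 'I_n -> set R) (beta : 'I_n -> R -> 'rV[R]_2),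
    [/\ similar_products I alpha J beta,
        forall i, regular_curve (J i) (beta i) &
        [\/ (forall i, in_unit_circle (J i) (beta i)) /\ a = n%:R^-1,
            exists k : nat,
              [/\ (1 <= k <= n - 1)%N,
                  forall i : 'I_n, (i < k)%N -> in_unit_circle (J i) (beta i),
                  forall i : 'I_n, (k <= i)%N -> in_real_line (J i) (beta i) &
                  a = k%:R^-1]
          | (forall i : 'I_n, i = 0%N :> nat -> icsf_soliton a (J i) (beta i)) /\
            (forall i : 'I_n, (0 < i)%N -> in_real_line (J i) (beta i))]]).
Proof.
have oI i : open (I i) by case: (hI i).
have I0 i : I i !=set0 by case: (hI i).
apply: (iff_trans (product_solitonP a oI halpha)); split=> [sol | ]; last first.
  move=> [J [beta [sim betaP model]]]; apply: (similar_solution hI halpha betaP sim).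
  have oJ i : open (J i) by case: sim => rho [f [tau [_ _ -> _]]].
  case: model => [[circ an] | [k [/andP[k0 kn] circ line ak]] | [icsf line]].
  - apply: (circles_lines_solution oJ betaP (k := n)) => //; first by rewrite hn /=.
    by move=> i; rewrite leqNgt ltn_ord.
  - apply: (circles_lines_solution oJ betaP (k := k)) => //.
    by rewrite k0 (leq_trans kn) ?leq_subr.
  pose i0 := Ordinal hn.
  apply: (icsf_lines_solution oJ betaP (i0 := i0)); first exact: icsf.
  move=> i ii0; apply: line; rewrite lt0n; apply: contraNneq ii0 => i_0.
  by apply/eqP/val_inj.
pose A := curved I (fun i => turning (alpha i)).
have [u uP] := exists_directions ha hI halpha sol.
have u1 i : edot (u i) (u i) = 1 by case: (uP i).
(* The new order puts the curved factors at the indices below [#|A|] and the lines after them. *)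
have [tau tauA] := exists_sorting_perm A.
have A0 : (0 < #|A|)%N by exact: curved_gt0 I0 _ sol.
have An : (#|A| <= n)%N by rewrite -[X in (_ <= X)%N]card_ord max_card.
have line (rho : R) (i : 'I_n) : (#|A| <= i)%N ->
    in_real_line (I (tau i)) (fun t => rho *: rot (u (tau i)) (alpha (tau i) t)).
  move=> Ai t It; have [_ _ ut] := uP (tau i).
  by rewrite mxE rotE1 (ut _ t It) ?mulr0 // tauA -leqNgt.
case: (ltngtP #|A| 1%N) => [A1 | A2 | A1].
- by have := leq_trans A1 A0; rewrite ltnn.
- have [r r0 [aA circle]] := solution_curved_ge2 ha hI halpha sol A2.
  (* This ratio brings the common radius of the circles to 1. *)
  have rho0 : 0 < Num.sqrt r^-1 by rewrite sqrtr_gt0 invr_gt0.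
  have [sim betaP] := similar_to_rotation hI halpha tau rho0 u1.
  have circ (i : 'I_n) : (i < #|A|)%N -> in_unit_circle (I (tau i))
      (fun t => Num.sqrt r^-1 *: rot (u (tau i)) (alpha (tau i) t)).
    move=> iA t It; rewrite /enorm edotZ sqr_sqrtr ?invr_ge0 ?ltW //.
    by rewrite edot_rot // (circle (tau i)) ?tauA // mulVf ?sqrtr1 // gt_eqF.
  exists (fun i => I (tau i)),
    (fun i t => Num.sqrt r^-1 *: rot (u (tau i)) (alpha (tau i) t)).
  (* All factors are curved in the first model; otherwise [#|A|] is the [k] of the second. *)
  split=> //; move: An; rewrite leq_eqVlt => /orP[/eqP An | An].
    by apply: Or31; split=> [i | ]; [apply: circ; rewrite An | rewrite aA An].
  apply: Or32; exists #|A|; split=> //; last by move=> i /line.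
  by rewrite A0 /= -ltnS subn1 prednK.
(* The only curved factor comes first; with ratio 1 and the trivial rotation it is kept as it is. *)
have [sim betaP] := similar_to_rotation hI halpha tau ltr01 u1.
exists (fun i => I (tau i)), (fun i t => 1 *: rot (u (tau i)) (alpha (tau i) t)).
split=> //; apply: Or33; split=> [i i_0 | i i_gt0]; last by apply: line; rewrite A1.
have iA : tau i \in A by rewrite tauA A1 i_0.
have [_ /(_ iA) -> _] := uP (tau i).
rewrite (_ : (fun t => _) = alpha (tau i)).
  exact: (solution_curved1 ha hI halpha sol A1 iA).
by apply/funext => t; rewrite scale1r rot_e1.
Qed.
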